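(* Let $R$ be a ring. Then the following hold. (1) If every element of $R$ is idempotent, then $P_R=\{0\}$. (2) If $a\in P_R$, then $a$ is a zero divisor element. (3) If $R$ has an identity element, then $P_R=\{0\}$.
   Context: Rings are associative, not necessarily commutative and not necessarily with identity. For a ring $R$ and $a\in R$, put $S_R^a=\{b\in R \mid aRb=(0)\}$, where $aRb=(0)$ means $acb=0$ for all $c\in R$. The source of primeness of $R$ is $P_R=\bigcap_{a\in R}S_R^a$. An element $e\in R$ is idempotent if $e^2=e$. An element $a\in R$ is a right (resp. left) zero-divisor if there exists a nonzero $b\in R$ with $ba=0$ (resp. $ab=0$); $a$ is called a zero divisor if it is both a left and a right zero-divisor.
   Formalization: Part (2) is stated only for rings with a nonzero element: in the zero ring R={0}, the element 0 lies in P_R but is not a zero divisor, since no nonzero b exists. *)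

(* Defs.v *)
From HB Require Import structures.
From mathcomp Require Import all_boot ssralg.
From mathcomp Require Import boolp classical_sets.

Set Implicit Arguments.
Unset Strict Implicit.
Unset Printing Implicit Defensive.

Import GRing.Theory.

(* The rings of the MathComp hierarchy all have an identity element, so rings
   that need not have one are the join of its additive groups and its
   (multiplicative) semigroups, related by distributivity.  The product is
   the semigroup law of group_scope, and 0 and + live in ring_scope. *)
HB.mixin Record Semigroup_Zmodule_isRng R of Semigroup R & GRing.Zmodule R := {
  rng_mulDl : left_distributive (@monoid.mul R) (@GRing.add R);
  rng_mulDr : right_distributive (@monoid.mul R) (@GRing.add R)
}.

#[short(type="rngType")]
HB.structure Definition Rng :=
  { R of Semigroup_Zmodule_isRng R & Semigroup R & GRing.Zmodule R }.

Local Open Scope classical_set_scope.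
Local Open Scope ring_scope.

(* The set S_R^a. *)
Definition prime_annihilator (R : rngType) (a : R) : set R :=
  [set b | forall c : R, (a * c * b)%g = 0].

(* The set P_R. *)
Definition source_of_primeness (R : rngType) : set R :=
  \bigcap_(a : R) prime_annihilator a.
Arguments source_of_primeness : clear implicits.

Definition rng_idempotent (R : rngType) (e : R) : Prop := (e * e)%g = e.

Definition right_zero_divisor (R : rngType) (a : R) : Prop :=
  exists b : R, b <> 0 /\ (b * a)%g = 0.

Definition left_zero_divisor (R : rngType) (a : R) : Prop :=
  exists b : R, b <> 0 /\ (a * b)%g = 0.

Definition zero_divisor (R : rngType) (a : R) : Prop :=
  left_zero_divisor a /\ right_zero_divisor a.

Definition has_identity (R : rngType) : Prop :=
  exists e : R, forall x : R, (e * x)%g = x /\ (x * e)%g = x.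

(* With the definition above, 0 is a zero divisor exactly when the ring has a
   nonzero element. *)
Definition nonzero_rng (R : rngType) : Prop := exists x : R, x <> 0.

(* Main.v *)
Require Import Defs.
From HB Require Import structures.
From mathcomp Require Import all_boot ssralg.
From mathcomp Require Import boolp classical_sets.
Local Open Scope classical_set_scope.
Local Open Scope ring_scope.

(** Membership of [a] in the source of primeness says that every product
    [x c a] vanishes.  Choosing [x] and [c] gives all three claims: for
    [x = c = a] with [a] idempotent, or [x = c] an identity element, [x c a]
    is [a] itself, so [a = 0];
    in general [x = c = a] gives [a a a = 0], so that a nonzero [a] is a zero
    divisor on both sides, witnessed by [a a] if that is nonzero and by [a]
    otherwise; [0] is a zero divisor as soon as [R] has a nonzero element. *)

Lemma rng_mul0r (R : rngType) (x : R) : (0 * x)%g = 0.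
Proof.
by apply: (GRing.addrI (0 * x)%g); rewrite -rng_mulDl !GRing.addr0.
Qed.

Lemma rng_mulr0 (R : rngType) (x : R) : (x * 0)%g = 0.
Proof.
by apply: (GRing.addrI (x * 0)%g); rewrite -rng_mulDr !GRing.addr0.
Qed.

Lemma source_of_primeness_mul (R : rngType) (a : R) :
  source_of_primeness R a -> forall x c : R, (x * c * a)%g = 0.
Proof. by move=> Pa x c; apply: (Pa x). Qed.

Lemma source_of_primeness0 (R : rngType) : source_of_primeness R 0.
Proof. by move=> x _ c; apply: rng_mulr0. Qed.

Lemma source_of_primeness_trivial (R : rngType) :
  (forall a : R, exists x c : R, (x * c * a)%g = a) ->
  source_of_primeness R = [set 0].
Proof.
move=> fixR; apply/seteqP; split=> [a Pa | _ ->] /=.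
  by have [x [c <-]] := fixR a; apply: source_of_primeness_mul.
exact: source_of_primeness0.
Qed.

Lemma zero_divisor0 (R : rngType) : nonzero_rng R -> zero_divisor (0 : R).
Proof.
by move=> [x x0]; split; exists x; split; rewrite ?rng_mul0r ?rng_mulr0.
Qed.

(** The last nonzero power among [a] and [a a] annihilates [a] on both sides,
    since it commutes with [a]. *)
Lemma zero_divisor_cube0 (R : rngType) (a : R) :
  a <> 0 -> (a * a * a)%g = 0 -> zero_divisor a.
Proof.
move=> a0 aaa0; have [aa0 | aa0] := EM ((a * a)%g = 0).
  by split; exists a.
by split; exists (a * a)%g; rewrite ?monoid.mulgA.
Qed.

Theorem lemma2p18 (R : rngType) :
  ((forall e : R, rng_idempotent e) -> source_of_primeness R = [set 0]) /\
  (nonzero_rng R ->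
     forall a : R, source_of_primeness R a -> zero_divisor a) /\
  (has_identity R -> source_of_primeness R = [set 0]).
Proof.
split; [|split].
- move=> idemR; apply: source_of_primeness_trivial => a.
  by exists a, a; rewrite !idemR.
- move=> nzR a Pa; have [-> | a0] := EM (a = 0); first exact: zero_divisor0.
  exact/zero_divisor_cube0/source_of_primeness_mul.
- move=> [e eP]; apply: source_of_primeness_trivial => a.
  by exists e, e; rewrite (eP e).1 (eP a).1.
Qed.
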